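(* Let $f:\mathbb{R}^n\to\mathbb{R}$ be a convex function. Then the single-valued map $G:\mathbb{R}^n\times(0,+\infty)\to\mathbb{R}^n$ defined by $G(x,\epsilon)=\operatorname{argmin}_{v\in\partial_\epsilon f(x)}\|v\|$, where $$\partial_\epsilon f(x)=\{v\mid f(z)\ge f(x)+v^\top(z-x)-\epsilon\ \text{ for all } z\}$$ is the $\epsilon$-subdifferential, is a descent-oriented subdifferential for $f$.
   Context: $\|\cdot\|$ is the Euclidean norm; $\mathbb{N}=\{0,1,2,\dots\}$; $\partial f$ is the Clarke subdifferential (for convex $f$, the usual convex subdifferential). A single-valued map is treated as a singleton-valued set-valued map. Set limits (Painlevé–Kuratowski). For a sequence of sets $\{C^k\}$ in $\mathbb{R}^n$, the outer limit $\limsup_{k\to+\infty}C^k$ is the set of all $u$ for which there are an infinite $N\subset\mathbb{N}$ and $u^k\in C^k$ ($k\in N$) with $u^k\to u$ as $k\to\infty$, $k\in N$; the inner limit $\liminf_{k\to+\infty}C^k$ is defined in the same way with $N\subset\mathbb{N}$ having finite complement. If the two coincide, their common value is $\lim_{k\to+\infty}C^k$. For sets $A_\epsilon$ ($\epsilon>0$), $\lim_{\epsilon\downarrow0}A_\epsilon=C$ means $\lim_{k\to+\infty}A_{\epsilon_k}=C$ for every sequence $\epsilon_k>0$ with $\epsilon_k\to0$. For $G:\mathbb{R}^n\times(0,+\infty)\rightrightarrows\mathbb{R}^n$: $\limsup_{x\to\bar x}G(x,\epsilon)$ ($\epsilon$ fixed) is the union of $\limsup_{k\to+\infty}G(x^k,\epsilon)$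 over all sequences $x^k\to\bar x$ ($x^k=\bar x$ is allowed); $\limsup_{\epsilon\downarrow0,\,x\to\bar x}G(x,\epsilon)$ is the union of $\limsup_{k\to+\infty}G(x^k,\epsilon_k)$ over all sequences $x^k\to\bar x$ and $\epsilon_k>0$ with $\epsilon_k\to0$. Definition. For a locally Lipschitz $f:\mathbb{R}^n\to\mathbb{R}$, $G$ is a descent-oriented subdifferential for $f$ if for each fixed $\epsilon>0$ the mapping $G(\cdot,\epsilon)$ is closed-valued and locally bounded (every $\bar x$ has a neighborhood $V$ with $\bigcup_{x\in V}G(x,\epsilon)$ bounded), and for all $\bar x\in\mathbb{R}^n$: (G1) $\limsup_{\epsilon\downarrow0,\,x\to\bar x}G(x,\epsilon)\subset\partial f(\bar x)$; (G2) $\lim_{\epsilon\downarrow0}\big(\limsup_{x\to\bar x}G(x,\epsilon)\big)=\operatorname{argmin}_{v\in\partial f(\bar x)}\|v\|$ (the singleton consisting of the minimal norm element of $\partial f(\bar x)$). *)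

(* Defs.v *)
(* R^n is ['rV[R]_n] for an arbitrary [R : realType]. *)
From HB Require Import structures.
From mathcomp Require Import all_boot all_order all_algebra.
From mathcomp Require Import all_classical all_reals all_analysis.

Set Implicit Arguments.
Unset Strict Implicit.
Unset Printing Implicit Defensive.

Import Order.TTheory GRing.Theory Num.Theory.
Import numFieldNormedType.Exports.

Local Open Scope classical_set_scope.
Local Open Scope ring_scope.

Section Euclidean.
Context {R : realType} {n : nat}.
Implicit Types u v : 'rV[R]_n.

Definition dotv u v : R := \sum_(i < n) u 0 i * v 0 i.

(* The library norm [`|v|] on ['rV[R]_n] is the sup norm. It is used below only
   through notions that do not depend on the choice of a norm on R^n (topology,
   boundedness, being Lipschitz); minimal norm elements are taken with respect
   to the Euclidean norm. *)
Definition enorm v : R := Num.sqrt (dotv v v).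

End Euclidean.

Definition argmin {T : Type} {R : realType} (h : T -> R) (C : set T) : set T :=
  [set v | C v /\ forall w, C w -> h v <= h w].

Section SetLimits.
Context {R : realType} {n : nat}.
Local Notation V := 'rV[R]_n.

(* Painleve-Kuratowski limits; the filter [within N \oo] expresses convergence
   along the indices of N, so the values of [u] outside N are irrelevant. *)
Definition outer_limit (C : nat -> set V) : set V :=
  [set l | exists (N : set nat) (u : nat -> V),
    [/\ infinite_set N, forall k, N k -> C k (u k) &
        u k @[k --> within N \oo] --> l]].

Definition inner_limit (C : nat -> set V) : set V :=
  [set l | exists (N : set nat) (u : nat -> V),
    [/\ finite_set (~` N), forall k, N k -> C k (u k) &
        u k @[k --> within N \oo] --> l]].

Definition set_limit (C : nat -> set V) (L : set V) : Prop :=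
  outer_limit C = L /\ inner_limit C = L.

Definition pos_null_seq (e : nat -> R) : Prop :=
  (forall k, 0 < e k) /\ e k @[k --> \oo] --> 0.

Definition set_limit_at0 (A : R -> set V) (L : set V) : Prop :=
  forall e : nat -> R, pos_null_seq e -> set_limit (fun k => A (e k)) L.

(* Mappings R^n x (0, +oo) => R^n are represented by [V -> R -> set V]; values
   at nonpositive second arguments are never used. *)
Definition limsup_x (G : V -> R -> set V) (xbar : V) (eps : R) : set V :=
  \bigcup_(x in [set x : nat -> V | x k @[k --> \oo] --> xbar])
    outer_limit (fun k => G (x k) eps).

Definition limsup_eps_x (G : V -> R -> set V) (xbar : V) : set V :=
  \bigcup_(p in [set p : (nat -> V) * (nat -> R) |
                  p.1 k @[k --> \oo] --> xbar /\ pos_null_seq p.2])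
    outer_limit (fun k => G (p.1 k) (p.2 k)).

End SetLimits.

Section Subdifferentials.
Context {R : realType} {n : nat}.
Local Notation V := 'rV[R]_n.
Implicit Types (f : V -> R) (G : V -> R -> set V).

Definition locally_lipschitz f : Prop :=
  forall x : V, exists2 U : set V, nbhs x U & [lipschitz f y : R^o | y in U].

(* Clarke's generalized directional derivative: the limsup, as y -> x and
   t decreases to 0, of (f (y + t d) - f y) / t. *)
Definition clarke_derivative f (x d : V) : \bar R :=
  limf_esup (fun p : V * R => ((f (p.1 + p.2 *: d) - f p.1) / p.2)%:E)
            (filter_prod (nbhs x) (0 : R)^'+).

Definition clarke_subdifferential f (x : V) : set V :=
  [set v | forall d : V, ((dotv v d)%:E <= clarke_derivative f x d)%E].

Definition eps_subdifferential f (x : V) (eps : R) : set V :=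
  [set v | forall z : V, f x + dotv v (z - x) - eps <= f z].

Record descent_oriented_subdifferential f G : Prop := {
  dos_lipschitz : locally_lipschitz f;
  dos_closed : forall (x : V) (eps : R), 0 < eps -> closed (G x eps);
  dos_locally_bounded : forall (xbar : V) (eps : R), 0 < eps ->
    exists2 U : set V, nbhs xbar U & bounded_set (\bigcup_(x in U) G x eps);
  dos_G1 : forall xbar : V,
    limsup_eps_x G xbar `<=` clarke_subdifferential f xbar;
  dos_G2 : forall xbar : V,
    set_limit_at0 (limsup_x G xbar)
                  (argmin enorm (clarke_subdifferential f xbar))
}.

End Subdifferentials.

(* Main.v *)
Require Import Defs.
From HB Require Import structures.
From mathcomp Require Import all_boot all_order all_algebra.
From mathcomp Require Import all_classical all_reals all_analysis.
From mathcomp Require Import ring lra.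
Import Order.TTheory GRing.Theory Num.Theory.
Import numFieldNormedType.Exports.
Local Open Scope classical_set_scope.
Local Open Scope ring_scope.

Set Implicit Arguments.
Unset Strict Implicit.
Unset Printing Implicit Defensive.

(** Writing [sub f x e] for the [e]-subdifferential, the theorem rests on four
    properties of it, for [f] convex and finite on R^n.

    (a) [sub f x 0] is nonempty: a linear minorant of [h |-> f (x + h) - f x] is
        extended one coordinate at a time, as in the Hahn-Banach theorem
        ([convex_subgradient_exists]).
    (b) Elements of [sub f x e] are bounded, locally uniformly in [x], because
        [f] is bounded on balls ([eps_subdifferential_bounded]).
    (c) The graph of [(x, e) |-> sub f x e] is closed, because [f] is continuous
        ([eps_subdifferential_limit]).
    (d) [sub f x 0] is the Clarke subdifferential
        ([clarke_subdifferential_convex]).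

    By (a)-(c) each [sub f x e] with [e >= 0] is a nonempty compact convex set,
    so it has exactly one element of minimal Euclidean norm. Local boundedness
    of [G] is (b), and (G1) is (c) together with (d).

    For (G2), let [m] be the minimal norm element of [sub f xbar 0]. For fixed
    [e > 0], continuity of [f] makes [m] an [e]-subgradient at every [x] close
    to [xbar] ([subgradient_near]), hence [G x e] has norm at most that of [m].
    So every element of the limsup of [G x e] as [x] tends to [xbar] is an
    [e]-subgradient at [xbar] of norm at most that of [m] ([limsup_x_argmin]).
    When [e] tends to 0, a limit point of such elements lies, by (c), in
    [sub f xbar 0] and its norm is at most that of [m], so it is [m]; by
    compactness the minimal norm elements of [sub f xbar (e k)] do converge to
    [m] ([cvg_min_subgradient]), which puts [m] in the inner limit. *)

(** * Euclidean geometry and topology of row vectors *)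

Section InnerProduct.
Context {R : realType} {n : nat}.
Implicit Types u v w : 'rV[R]_n.

Lemma dotvC u v : dotv u v = dotv v u.
Proof. by apply: eq_bigr => i _; rewrite mulrC. Qed.

Lemma dotvDr u v w : dotv u (v + w) = dotv u v + dotv u w.
Proof. by rewrite -big_split; apply: eq_bigr => i _; rewrite mxE mulrDr. Qed.

Lemma dotvZr a u v : dotv u (a *: v) = a * dotv u v.
Proof. by rewrite mulr_sumr; apply: eq_bigr => i _; rewrite mxE mulrCA. Qed.

Lemma dotvDl u v w : dotv (u + v) w = dotv u w + dotv v w.
Proof. by rewrite dotvC dotvDr !(dotvC w). Qed.

Lemma dotvZl a u v : dotv (a *: u) v = a * dotv u v.
Proof. by rewrite dotvC dotvZr dotvC. Qed.

Lemma dotv0 u : dotv u 0 = 0.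
Proof. by rewrite -(scale0r 0) dotvZr mul0r. Qed.

Lemma dotv_delta u i : dotv u (delta_mx 0 i) = u 0 i.
Proof.
rewrite /dotv (bigD1 i)//= mxE !eqxx mulr1 big1 ?addr0// => j /negbTE ji.
by rewrite mxE ji andbF mulr0.
Qed.

Lemma dotv_ge0 u : 0 <= dotv u u.
Proof. by apply: sumr_ge0 => i _; exact: sqr_ge0. Qed.

Lemma dotv_eq0 u : dotv u u <= 0 -> u = 0.
Proof.
move=> u0; apply/rowP => i; rewrite mxE.
have /eqP : dotv u u = 0 by apply/eqP; rewrite eq_le u0 dotv_ge0.
rewrite psumr_eq0 => [/allP/(_ i)|j _]; last exact: sqr_ge0.
by rewrite mem_index_enum mulf_eq0 orbb => /(_ isT)/eqP.
Qed.

Lemma enorm_le u v : (enorm u <= enorm v) = (dotv u u <= dotv v v).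
Proof. by rewrite ler_sqrt ?dotv_ge0. Qed.

Lemma cvg_dotv T (F : set_system T) (FF : Filter F) (u v : T -> 'rV[R]_n) a b :
  u @ F --> a -> v @ F --> b -> dotv (u t) (v t) @[t --> F] --> dotv a b.
Proof.
have coord (w : T -> 'rV[R]_n) (c : 'rV[R]_n) i :
    w @ F --> c -> w t 0 i @[t --> F] --> c 0 i.
  by move=> wc; apply: cvg_comp wc (@coord_continuous R 1 n 0 i c).
move=> ua vb; apply: cvg_big => [|i _]; first exact: add_continuous.
by apply: cvgM; apply: coord.
Qed.

Lemma enorm_continuous : continuous (@enorm R n).
Proof.
move=> v; have dv : dotv w w @[w --> v] --> dotv v v.
  by apply: (@cvg_dotv _ (nbhs v) _ id id).
exact: (cvg_comp _ _ dv (@sqrt_continuous R (dotv v v))).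
Qed.

Lemma enorm_ball_closed c : closed [set v : 'rV[R]_n | enorm v <= c].
Proof.
apply: (@preimage_closed _ R (@enorm R n) [set r | r <= c]).
  by move=> v _; exact: (@enorm_continuous v).
exact: closed_le.
Qed.

Lemma near_norm_le v d : 0 < d -> \forall w \near v, `|v - w| <= d.
Proof. exact: (@cvgr_dist_le R 'rV[R]_n _ (nbhs v) _ id v). Qed.

Lemma coord_le_norm v i : `|v 0 i| <= `|v|.
Proof.
rewrite [leRHS]/Num.norm /= mx_normrE.
by apply: (@le_bigmax _ _ _ 0 (fun j : 'I_1 * 'I_n => `|v j.1 j.2|) (0, i)).
Qed.

Lemma norm_le_coord v M : 0 <= M -> (forall i, `|v 0 i| <= M) -> `|v| <= M.
Proof.
move=> M0 vM; rewrite [leLHS]/Num.norm /= mx_normrE; apply/bigmax_leP; split=> //.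
by move=> [i j] _ /=; rewrite ord1.
Qed.

Lemma norm_delta i : `|delta_mx 0 i : 'rV[R]_n| = 1.
Proof.
apply/eqP; rewrite eq_le; apply/andP; split.
  apply: norm_le_coord => // j; rewrite mxE.
  by case: (_ && _); rewrite ?normr1 ?normr0.
by have := coord_le_norm (delta_mx 0 i) i; rewrite mxE !eqxx normr1.
Qed.

(** Vectors with vanishing coordinates from [k] on: the flag of coordinate
    subspaces along which statements on R^n are proved by induction. *)
Definition supported k v := forall i : 'I_n, (k <= i)%N -> v 0 i = 0.

Lemma supported0 v : supported 0 v -> v = 0.
Proof. by move=> v0; apply/rowP => i; rewrite mxE v0. Qed.

Lemma supported_full k v : (n <= k)%N -> supported k v.
Proof. by move=> nk i /(leq_trans nk); rewrite leqNgt ltn_ord. Qed.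

Lemma supported_sub (i : 'I_n) v : supported i.+1 v ->
  supported i (v - v 0 i *: delta_mx 0 i).
Proof.
move=> vi j ij; rewrite !mxE eqxx /=; have [->|ji] := eqVneq j i.
  by rewrite mulr1 subrr.
by rewrite vi ?mulr0 ?subr0// ltn_neqAle ij andbT eq_sym.
Qed.

Lemma bounded_set_le (A : set 'rV[R]_n) M :
  (forall v, A v -> `|v| <= M) -> bounded_set A.
Proof.
move=> AM; exists M; split; first exact: num_real.
by move=> B MB v Av /=; exact: le_trans (AM v Av) (ltW MB).
Qed.

(** Compactness gives existence. Two minimizers [v] and [w] coincide because
    the parallelogram identity makes their midpoint shorter by
    a quarter of the squared length of [w - v]. *)
Lemma argmin_enorm_set1 (C : set 'rV[R]_n) : C !=set0 -> compact C ->
  (forall u v, C u -> C v -> C (2^-1 *: (u + v))) ->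
  exists v, argmin enorm C = [set v].
Proof.
move=> C0 cC midC.
have [] := EVT_min_rV C0 cC (continuous_subspaceT (@enorm_continuous)).
move=> v; rewrite inE => Cv vmin; have {}vmin w : C w -> enorm v <= enorm w.
  by move=> Cw; apply: vmin; rewrite inE.
exists v; apply/seteqP; split => [w [Cw wmin]|_ ->]; last by [].
have := vmin _ (midC _ _ Cv Cw); have := wmin _ Cv; have := vmin _ Cw.
rewrite !enorm_le dotvZl dotvZr !(dotvDl, dotvDr) (dotvC w v) => h1 h2 h3.
apply/eqP; rewrite -subr_eq0; apply/eqP/dotv_eq0.
rewrite -scaleN1r !(dotvDl, dotvDr, dotvZl, dotvZr) (dotvC w v); lra.
Qed.

End InnerProduct.

(** * Boundedness, continuity and subgradients of finite convex functions *)

Section Convex.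
Context {R : realType} {n : nat}.
Variable f : 'rV[R]_n -> R.
Hypothesis fcvx : convex_function [set: 'rV[R]_n] f.
Implicit Types u v w x y z : 'rV[R]_n.

Lemma convex_segment x y t : 0 <= t -> t <= 1 ->
  f (t *: x + (1 - t) *: y) <= t * f x + (1 - t) * f y.
Proof. by move=> t0 t1; apply: (fcvx (Itv01 t0 t1)); rewrite inE. Qed.

(** Induction along the flag of coordinate subspaces: a vector supported on
    [k.+1] coordinates is the midpoint of twice its projection to the first [k]
    and twice its component along the last one, and on a segment of a line [f]
    is bounded through its values at the ends. *)
Lemma convex_bounded_above x r : 0 < r ->
  exists M, forall y, `|y - x| <= r -> f y <= M.
Proof.
suff bnd k : forall r, 0 < r -> exists M, forall h : 'rV[R]_n,
    supported k h -> `|h| <= r -> f (x + h) <= M.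
  move=> r0; have [M HM] := bnd n r r0; exists M => y yr.
  by rewrite -[y](subrK x) addrC; apply: HM => //; exact: supported_full.
elim: k => [s _|k IH s s0].
  by exists (f x) => h /supported0 -> _; rewrite addr0.
have [nk|kn] := leqP n k.
  by have [M HM] := IH s s0; exists M => h _; apply: HM; exact: supported_full.
pose i0 := Ordinal kn; pose e : 'rV[R]_n := delta_mx 0 i0.
(* Doubling the projection [h'], whose sup norm is at most [2 * s], asks for the
   radius [4 * s]. *)
have [M HM] := IH (4 * s) ltac:(lra).
pose a := f (x + (2 * s) *: e); pose b := f (x - (2 * s) *: e).
exists (2^-1 * M + 2^-1 * (`|a| + `|b|)) => h h0 hs.
pose t := h 0 i0; pose h' := h - t *: e.
have ts : `|t| <= s by apply: le_trans hs; exact: coord_le_norm.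
have fline : f (x + (2 * t) *: e) <= `|a| + `|b|.
  pose l := (t + s) / (2 * s).
  have [tl tu] : - s <= t /\ t <= s by apply/andP; rewrite -ler_norml.
  have l0 : 0 <= l by apply: divr_ge0; lra.
  have l1 : l <= 1 by rewrite ler_pdivrMr; lra.
  have -> : x + (2 * t) *: e =
      l *: (x + (2 * s) *: e) + (1 - l) *: (x - (2 * s) *: e).
    by apply/rowP => j; rewrite !mxE /l; field; lra.
  apply: le_trans (convex_segment _ _ l0 l1) _; rewrite -/a -/b.
  have := ler_norm a; have := ler_norm b => hb ha.
  have : l * a <= `|a|.
    apply: le_trans (ler_wpM2l l0 ha) _; exact: ler_piMl.
  have : (1 - l) * b <= `|b|; last lra.
  apply: le_trans (ler_wpM2l _ hb) _; first lra.
  by apply: ler_piMl => //; lra.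
have fh' : f (x + 2 *: h') <= M.
  apply: HM => [i ki|].
    by rewrite mxE (@supported_sub _ _ i0 _ h0 i ki) mulr0.
  rewrite normrZ; have := ler_normB h (t *: e).
  rewrite normrZ norm_delta normr_nat -/h'; lra.
have -> : x + h = 2^-1 *: (x + 2 *: h') + (1 - 2^-1) *: (x + (2 * t) *: e).
  by apply/rowP => j; rewrite !mxE; field.
apply: le_trans (convex_segment _ _ _ _) _; lra.
Qed.

(** The lower bound at [y] follows from the upper bound at the reflection
    [2 *: x - y] of [y] through [x]. *)
Lemma convex_bounded x r : 0 < r ->
  exists B, forall y, `|y - x| <= r -> `|f y| <= B.
Proof.
move=> r0; have [M HM] := convex_bounded_above x r0.
exists (`|M| + 2 * `|f x|) => y yr.
have fyM := HM _ yr.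
have fy'M : f (2 *: x - y) <= M.
  apply: HM; have -> : 2 *: x - y - x = x - y; last by rewrite distrC.
  by apply/rowP => j; rewrite !mxE; ring.
have : f x <= 2^-1 * f y + (1 - 2^-1) * f (2 *: x - y).
  rewrite [in leLHS](_ : x = 2^-1 *: y + (1 - 2^-1) *: (2 *: x - y)).
    by apply: convex_segment; lra.
  by apply/rowP => j; rewrite !mxE; field.
have := ler_norm M; have := ler_norm (- f x); have := ler_norm (f x).
have := normr_ge0 (f x); rewrite normrN ler_norml => *; apply/andP; split; lra.
Qed.

(** Prolonging the segment from [y] to [z] by length 1 stays in the ball of
    radius 2, where [f] is bounded by some [B]; slopes of [f] along it increase,
    so the slope between [y] and [z] is at most [2 * B]. *)
Lemma convex_lipschitz_ball x : exists K, forall y z,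
  `|y - x| <= 1 -> `|z - x| <= 1 -> `|f y - f z| <= K * `|y - z|.
Proof.
have [B HB] := convex_bounded x (ltr0n R 2).
exists (2 * B).
suff main y z : `|y - x| <= 1 -> `|z - x| <= 1 -> f z - f y <= 2 * B * `|z - y|.
  move=> y z yx zx; rewrite ler_norml.
  have := main _ _ yx zx; have := main _ _ zx yx; rewrite (distrC z y) => *.
  by apply/andP; split; lra.
move=> yx zx; have [->|zy] := eqVneq z y.
  by rewrite !subrr normr0 mulr0.
pose d := `|z - y|; have d0 : 0 < d by rewrite normr_gt0 subr_eq0.
pose z' := z + d^-1 *: (z - y).
have z'x : `|z' - x| <= 2.
  rewrite /z' addrAC; apply: le_trans (ler_normD _ _) _.
  suff -> : `|d^-1 *: (z - y)| = 1 by lra.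
  by rewrite normrZ -/d ger0_norm ?invr_ge0 ?ltW// mulVf// gt_eqF.
pose l := d / (1 + d).
have l0 : 0 <= l by apply: divr_ge0; lra.
have l1 : l <= 1 by rewrite ler_pdivrMr; lra.
have ld : l <= d by rewrite ler_pdivrMr; have := sqr_ge0 d; rewrite ?expr2; lra.
have := convex_segment z' y l0 l1.
have -> : l *: z' + (1 - l) *: y = z.
  by apply/rowP => j; rewrite !mxE /l; field; rewrite !gt_eqF//; lra.
have := HB _ z'x; have := HB y ltac:(lra); rewrite !ler_norml -/d.
move=> /andP[? ?] /andP[? ?] ?; nra.
Qed.

Lemma convex_continuous : continuous f.
Proof.
move=> x; have [K HK] := convex_lipschitz_ball x.
apply/(@cvgrPdist_le R R^o _ (nbhs x)) => e e0.
have K0 : 0 < `|K| + 1 by rewrite ltr_wpDl.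
apply: filterS2 (near_norm_le x ltr01)
  (near_norm_le x (divr_gt0 e0 K0)) => y y1 ye.
apply: le_trans (HK x y _ _) _; rewrite ?subrr ?normr0//; first by rewrite distrC.
apply: (@le_trans _ _ ((`|K| + 1) * `|x - y|)).
  by apply: ler_wpM2r => //; have := ler_norm K; lra.
by rewrite mulrC -ler_pdivlMr.
Qed.

(** Hahn-Banach extension along the flag of coordinate subspaces. The values
    allowed at a new basis vector [e] are those between the left slopes
    [(dotv v w - g (w - s *: e)) / s] and the right slopes
    [(g (z + t *: e) - dotv v z) / t]; convexity of [g] puts every left slope
    below every right slope, and the supremum of the left ones is taken. *)
Lemma convex_subgradient_exists x : exists v, eps_subdifferential f x 0 v.
Proof.
pose g (h : 'rV[R]_n) : R := f (x + h) - f x.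
have gcvx (s t : R) (a b : 'rV[R]_n) : 0 < s -> 0 < t ->
    (s + t) * g ((s + t)^-1 *: (s *: a + t *: b)) <= s * g a + t * g b.
  move=> s0 t0; pose l := s / (s + t).
  have l0 : 0 <= l by apply: divr_ge0; lra.
  have l1 : l <= 1 by rewrite ler_pdivrMr; lra.
  have := convex_segment (x + a) (x + b) l0 l1.
  have -> : l *: (x + a) + (1 - l) *: (x + b) =
      x + (s + t)^-1 *: (s *: a + t *: b).
    by apply/rowP => j; rewrite !mxE /l; field; lra.
  rewrite /g => cvx.
  have {cvx} := ler_wpM2l (addr_ge0 (ltW s0) (ltW t0)) cvx.
  have -> : (s + t) * (l * f (x + a) + (1 - l) * f (x + b)) =
      s * f (x + a) + t * f (x + b) by rewrite /l; field; lra.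
  lra.
suff main k : exists v, forall h : 'rV[R]_n,
    supported k h -> dotv v h <= g h.
  have [v vg] := main n; exists v => z; rewrite subr0 -lerBrDl.
  by have := vg (z - x); rewrite /g (addrC x) subrK; apply; exact: supported_full.
elim: k => [|k [v vg]].
  by exists 0 => h /supported0 ->; rewrite /g addr0 subrr dotv0.
have [nk|kn] := leqP n k.
  by exists v => h _; apply: vg; exact: supported_full.
pose i0 := Ordinal kn; pose e : 'rV[R]_n := delta_mx 0 i0.
pose low : set R := [set r | exists s w,
  [/\ 0 < s, supported k w & r = (dotv v w - g (w - s *: e)) / s]].
have low_le l t z : low l -> 0 < t -> supported k z ->
    l <= (g (z + t *: e) - dotv v z) / t.
  move=> [s [w [s0 wk ->]]] t0 zk.
  rewrite ler_pdivrMr// mulrAC ler_pdivlMr//.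
  have := gcvx s t (z + t *: e) (w - s *: e) s0 t0.
  have -> : s *: (z + t *: e) + t *: (w - s *: e) = s *: z + t *: w.
    by apply/rowP => j; rewrite !mxE; ring.
  have := vg ((s + t)^-1 *: (s *: z + t *: w)).
  rewrite dotvZr dotvDr !dotvZr ler_pdivrMl ?addr_gt0// => vle gle.
  suff : s * dotv v z + t * dotv v w <= s * g (z + t *: e) + t * g (w - s *: e).
    lra.
  apply: le_trans gle; apply: vle => i ki.
  by rewrite !mxE zk// wk// !mulr0 addr0 mulr0.
have supp0 : supported k (0 : 'rV[R]_n) by move=> i _; rewrite mxE.
have low0 : low !=set0 by exists ((dotv v 0 - g (0 - 1 *: e)) / 1), 1, 0.
have lowub : has_ubound low.
  by exists ((g (0 + 1 *: e) - dotv v 0) / 1) => l Hl; apply: low_le.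
pose a := sup low.
exists (v + (a - v 0 i0) *: e) => h hk.
pose t := h 0 i0; pose z := h - t *: e.
have zk : supported k z := @supported_sub _ _ i0 _ hk.
have hE : h = z + t *: e by rewrite subrK.
have -> : dotv (v + (a - v 0 i0) *: e) h = dotv v z + a * t.
  rewrite dotvDl dotvZl (dotvC e) dotv_delta -/t.
  by rewrite [X in dotv v X]hE dotvDr dotvZr dotv_delta; ring.
have [t0|t0|t0] := ltgtP t 0.
- have : (dotv v z - g (z - (- t) *: e)) / (- t) <= a.
    apply: ub_le_sup => //; exists (- t), z; split=> //; lra.
  rewrite scaleNr opprK -hE ler_pdivrMr ?oppr_gt0//; lra.
- have : a <= (g h - dotv v z) / t.
    by apply: ge_sup => // l Hl; rewrite hE; apply: low_le.
  rewrite ler_pdivlMr//; lra.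
- have zh : z = h by rewrite /z t0 scale0r subr0.
  by rewrite t0 mulr0 addr0 -[in leRHS]zh; apply: vg.
Qed.

(** * Epsilon-subdifferentials *)

(** By convexity the difference quotient at [y] with step [t <= 1] is at most
    [f (y + d) - f y], which is close to [f (x + d) - f x] for [y] near [x];
    this bounds the Clarke derivative from above. It is bounded from below by
    the quotients at [y = x], where the subgradient inequality applies. *)
Lemma clarke_subdifferential_convex x :
  clarke_subdifferential f x = eps_subdifferential f x 0.
Proof.
apply/seteqP; split=> v vx.
- move=> z; rewrite subr0 addrC -lerBrDr; pose d := z - x.
  apply/ler_addgt0Pr => e e0; rewrite -lee_fin -/d.
  apply: le_trans (vx d) _; rewrite /clarke_derivative.
  pose V := [set p : 'rV[R]_n * R |
    (f (p.1 + p.2 *: d) - f p.1) / p.2 <= f z - f x + e].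
  apply: (@le_trans _ _ (ereal_sup [set
      ((f (p.1 + p.2 *: d) - f p.1) / p.2)%:E | p in V])).
    apply: ereal_inf_lbound; exists V => //.
    exists ([set y | f (y + d) - f y <= f z - f x + e], [set t | 0 < t <= 1]).
      split=> /=.
        have c1 : f (y + d) - f y @[y --> x] --> f (x + d) - f x.
          have cd : y + d @[y --> x] --> x + d.
            apply: (@cvgD R 'rV[R]_n _ (nbhs x) _ id (cst d)) => //.
            exact: cvg_cst.
          have cf : f (y + d) @[y --> x] --> f (x + d).
            exact: (cvg_comp _ _ cd (@convex_continuous (x + d))).
          exact: (@cvgB R R^o _ (nbhs x) _ _ _ _ _ cf (@convex_continuous x)).
        rewrite -[z](subrK x) -/d (addrC d).
        have := @cvgr_le _ _ (nbhs x) _ _ _ c1; apply.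
        by rewrite ltrDl.
      near=> t; apply/andP; split; near: t; last exact: nbhs_right_le.
      exact: nbhs_right_gt.
    move=> [y t] [/= yV /andP[t0 t1]]; rewrite /V /=.
    apply: le_trans yV; rewrite ler_pdivrMr//.
    have := convex_segment (y + d) y (ltW t0) t1.
    have -> : t *: (y + d) + (1 - t) *: y = y + t *: d.
      by apply/rowP => j; rewrite !mxE; ring.
    lra.
  by apply: ge_ereal_sup => _ [p pV <-]; rewrite lee_fin.
- move=> d; apply: le_ereal_inf_tmp => _ [V [[A B] [/= Ax B0] AB] <-].
  have [t [Bt t0]] : exists t, B t /\ 0 < t.
    near (0 : R)^'+ => t; exists t; split; near: t => //.
    exact: nbhs_right_gt.
  apply: (@le_trans _ _ ((f (x + t *: d) - f x) / t)%:E); last first.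
    apply: ereal_sup_ubound; exists (x, t) => //.
    by apply: AB; split => //=; exact: nbhs_singleton.
  rewrite lee_fin ler_pdivlMr//; have := vx (x + t *: d).
  have -> : x + t *: d - x = t *: d by rewrite addrAC subrr add0r.
  rewrite dotvZr; lra.
Unshelve. all: by end_near. Qed.

(** Stated for an arbitrary filter so that it serves for closedness of one
    epsilon-subdifferential and for limits along infinite sets of indices. *)
Lemma eps_subdifferential_limit T (F : set_system T) (FF : ProperFilter F)
    (xk vk : T -> 'rV[R]_n) (ek : T -> R) x v e :
  xk @ F --> x -> vk @ F --> v -> ek @ F --> e ->
  (\forall k \near F, eps_subdifferential f (xk k) (ek k) (vk k)) ->
  eps_subdifferential f x e v.
Proof.
move=> xkx vkv eke sub z.
have fxk : f (xk k) @[k --> F] --> f x.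
  exact: (cvg_comp _ _ xkx (@convex_continuous x)).
have lhs : f (xk k) + dotv (vk k) (z - xk k) - ek k @[k --> F] -->
    f x + dotv v (z - x) - e.
  apply: (@cvgB R R^o) => //; apply: (@cvgD R R^o) => //.
  by apply: cvg_dotv => //; apply: cvgB => //; exact: cvg_cst.
have sub' : \forall k \near F,
    f (xk k) + dotv (vk k) (z - xk k) - ek k <= f z.
  by apply: filterS sub => k; exact.
exact: (@closed_cvg T R F FF _ (fun r => r <= f z) (@closed_le R _) sub' _ lhs).
Qed.

Lemma eps_subdifferential_closed x e : closed (eps_subdifferential f x e).
Proof.
move=> v /= vx.
have FF : ProperFilter (within (eps_subdifferential f x e) (nbhs v)).
  exact: within_nbhs_proper.
apply: (@eps_subdifferential_limit _ _ FF (fun=> x) id (fun=> e)).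
- exact: cvg_cst.
- exact: cvg_within.
- exact: (@cvg_cst R^o).
- exact: withinT.
Qed.

(** Testing the defining inequality at the points [x + s *: delta_mx 0 i] with
    [s] equal to 1 or -1 bounds each coordinate of [v] by a difference of values
    of [f] on the ball of radius 2, plus [e]. *)
Lemma eps_subdifferential_bounded xbar : exists C, forall x v e,
  `|x - xbar| <= 1 -> eps_subdifferential f x e v -> `|v| <= C + `|e|.
Proof.
have [B HB] := convex_bounded xbar (ltr0n R 2).
exists (2 * B) => x v e x1 vx.
have Bx : `|f x| <= B by apply: HB; lra.
have B0 : 0 <= B by apply: le_trans Bx.
have ee := ler_norm e.
have bnd i s : `|s| = 1 -> s * v 0 i <= 2 * B + `|e|.
  move=> s1; pose z := x + s *: delta_mx 0 i : 'rV[R]_n.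
  have Bz : `|f z| <= B.
    apply: HB; rewrite /z addrAC; apply: le_trans (ler_normD _ _) _.
    by rewrite normrZ norm_delta s1; lra.
  have zx : z - x = s *: delta_mx 0 i by rewrite /z addrAC subrr add0r.
  have := vx z; rewrite zx dotvZr dotv_delta.
  have := ler_norm (f z); have := ler_norm (- f x); rewrite normrN; lra.
apply: norm_le_coord => [|i]; first by have := normr_ge0 e; lra.
rewrite ler_norml; have := bnd i 1 (normr1 R).
have := bnd i (-1) _; rewrite normrN1 => /(_ erefl) => *; apply/andP; split; lra.
Qed.

Lemma argmin_eps_subdifferential_set1 x e : 0 <= e ->
  exists v, argmin enorm (eps_subdifferential f x e) = [set v].
Proof.
move=> e0; apply: argmin_enorm_set1.
- have [v vx] := convex_subgradient_exists x; exists v => z.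
  by apply: le_trans (vx z); rewrite subr0 gerBl.
- apply: bounded_closed_compact; last exact: eps_subdifferential_closed.
  have [C HC] := eps_subdifferential_bounded x.
  apply: (@bounded_set_le _ _ _ (C + `|e|)) => v vx.
  by apply: HC vx; rewrite subrr normr0.
- move=> u v ux vx z; rewrite dotvZl dotvDl.
  have := ux z; have := vx z; lra.
Qed.

(** A cluster point of [w] lies in every [eps_subdifferential f x d] with
    [d > 0], hence in their intersection [eps_subdifferential f x 0], and its
    norm is at most that of [m]; so it is [m]. A sequence in a compact set with
    a single cluster point converges to it. *)
Lemma cvg_min_subgradient x m (w : nat -> 'rV[R]_n) (e : nat -> R) :
  argmin enorm (eps_subdifferential f x 0) = [set m] -> pos_null_seq e ->
  (forall k, eps_subdifferential f x (e k) (w k)) ->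
  (forall k, enorm (w k) <= enorm m) ->
  w k @[k --> \oo] --> m.
Proof.
move=> mE [e0 ecvg] we wm.
have [_ mmin] : argmin enorm (eps_subdifferential f x 0) m by rewrite mE.
have near_e d : 0 < d -> \forall k \near \oo, eps_subdifferential f x d (w k).
  move=> d0; have ed : \forall k \near \oo, e k <= d.
    exact: (@cvgr_le R nat \oo _ e 0 ecvg d d0).
  apply: filterS ed => k kd z.
  by apply: le_trans (we k z); lra.
have clu v : cluster (w k @[k --> \oo]) v -> v = m.
  rewrite clusterE => cv; suff : argmin enorm (eps_subdifferential f x 0) v.
    by rewrite mE.
  have clo A : closed A -> (\forall k \near \oo, A (w k)) -> A v.
    by move=> cA wA; rewrite ((closure_id A).1 cA); exact: cv.
  split=> [z|u /mmin]; last first.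
    apply: le_trans.
    apply: (clo [set v | enorm v <= enorm m] (@enorm_ball_closed R n _)).
    exact: nearW.
  apply/ler_addgt0Pr => d d0; rewrite subr0.
  have := clo _ (@eps_subdifferential_closed x d) (near_e d d0); move/(_ z); lra.
have [C HC] := eps_subdifferential_bounded x.
(* [`|C| + 1] bounds the tail of [w], and [`|m| + 1] makes [V] a neighborhood
   of [m]. *)
pose M := `|C| + 1 + `|m| + 1; pose V := [set v : 'rV[R]_n | `|v| <= M].
have cV : compact V.
  apply: bounded_closed_compact; first exact: (@bounded_set_le _ _ V M).
  apply: (@preimage_closed _ _ (@Num.norm _ 'rV[R]_n) [set r | r <= M]).
    by move=> v _; exact: norm_continuous.
  exact: closed_le.
have wV : \forall k \near \oo, V (w k).
  apply: filterS (near_e 1 ltr01) => k wk; rewrite /V /=.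
  have := HC x (w k) 1; rewrite subrr normr0 normr1 => /(_ ler01 wk).
  have := ler_norm C; have := normr_ge0 m; rewrite /M; lra.
apply: (@compact_cluster_set1 _ m _ V) => //.
- apply: filterS (near_norm_le m ltr01) => y ym; rewrite /V /=.
  have := ler_distD m y 0.
  by rewrite !subr0 distrC /M; have := normr_ge0 C; lra.
- apply/seteqP; split=> [v /clu ->//|_ ->].
  by have [v [_ cv]] := cV (w @ \oo) _ wV; rewrite -(clu v cv).
Qed.

End Convex.

(** * Set limits *)

Lemma infinite_within_proper (N : set nat) :
  infinite_set N -> ProperFilter (within N \oo).
Proof.
move=> infN; apply: Build_ProperFilter_ex => P [M _ MP].
apply: contrapT => noP; apply: infN.
apply: sub_finite_set (finite_II M) => k Nk /=; rewrite ltnNge.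
by apply/negP => Mk; apply: noP; exists k; apply: MP.
Qed.

Lemma inner_limit_sub_outer (R : realType) n (C : nat -> set 'rV[R]_n) :
  inner_limit C `<=` outer_limit C.
Proof.
move=> l [N [u [finN uC ul]]]; exists N, u; split=> // infN.
by apply: infinite_nat; rewrite -(setUv N) finite_setU.
Qed.

(** * Minimal norm epsilon-subgradients near a point *)

Section DescentOriented.
Context {R : realType} {n : nat}.
Variable f : 'rV[R]_n -> R.
Hypothesis fcvx : convex_function [set: 'rV[R]_n] f.
Local Notation G := (fun x e => argmin enorm (eps_subdifferential f x e)).

(** Moving the base point from [x] to [y] changes the affine minorant given by
    [m] at the base point by [f y - f x - dotv m (y - x)], which tends to 0. *)
Lemma subgradient_near x m e : 0 < e -> eps_subdifferential f x 0 m ->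
  \forall y \near x, eps_subdifferential f y e m.
Proof.
move=> e0 mx.
have c : f y - dotv m (y - x) @[y --> x] --> f x - dotv m (x - x).
  have fx := @convex_continuous R n f fcvx x.
  apply: (@cvgB R R^o _ (nbhs x) _ _ _ _ _ fx).
  apply: cvg_dotv; first exact: cvg_cst.
  by apply: (@cvgB R 'rV[R]_n _ (nbhs x) _ id (cst x)); [|exact: cvg_cst].
rewrite subrr dotv0 subr0 in c.
have fxe : f x < f x + e by rewrite ltrDl.
have cl : \forall y \near x, f y - dotv m (y - x) <= f x + e.
  exact: (@cvgr_le R _ (nbhs x) _ _ _ c _ fxe).
apply: filterS cl => y ye z; have := mx z.
have -> : z - x = (z - y) + (y - x) by rewrite addrA subrK.
rewrite dotvDr; lra.
Qed.

(** The norm bound holds because [m] competes in the minimization that defines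
    [G y e] for [y] near [x]. *)
Lemma limsup_x_argmin x m e v : 0 < e -> eps_subdifferential f x 0 m ->
  limsup_x G x e v -> eps_subdifferential f x e v /\ enorm v <= enorm m.
Proof.
move=> e0 mx [xk /= xkx [N [u [infN uG uv]]]].
have FF := infinite_within_proper infN.
have xkN : xk k @[k --> within N \oo] --> x.
  by apply: cvg_trans xkx; apply: cvg_app; exact: cvg_within.
have NN : \forall k \near within N \oo, N k by exact: withinT.
split.
  apply: (eps_subdifferential_limit fcvx FF (ek := fun=> e) xkN uv).
    exact: (@cvg_cst R^o).
  by apply: filterS NN => k /uG[].
apply: (@closed_cvg _ _ _ FF u (fun w => enorm w <= enorm m)
  (@enorm_ball_closed R n _) _ v uv).
have := xkN _ (subgradient_near e0 mx); apply: filterS2 NN => k Nk mk.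
by have [_] := uG k Nk; exact.
Qed.

End DescentOriented.

Theorem proposition4 (R : realType) (n : nat) (f : 'rV[R]_n -> R) :
  convex_function [set: 'rV[R]_n] f ->
  (forall (x : 'rV[R]_n) (eps : R), 0 < eps ->
     exists v : 'rV[R]_n, argmin enorm (eps_subdifferential f x eps) = [set v])
  /\ descent_oriented_subdifferential f
       (fun (x : 'rV[R]_n) (eps : R) => argmin enorm (eps_subdifferential f x eps)).
Proof.
move=> fcvx; have ex1 x e (e0 : 0 < e) :=
  argmin_eps_subdifferential_set1 fcvx x (ltW e0).
split=> //; split.
- move=> x; have [K HK] := convex_lipschitz_ball fcvx x.
  exists [set y | `|x - y| <= 1]; first exact: near_norm_le.
  have ne : ([set y | `|x - y| <= 1] `*` [set y | `|x - y| <= 1]) (x, x).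
    by split; rewrite /= subrr normr0.
  apply: (@klipschitzW _ _ _ K); first exact: globally_properfilter ne.
  by move=> [y z] [/= yx zx]; apply: HK; rewrite distrC.
- move=> x e e0; have [v ->] := ex1 x e e0.
  exact/accessible_closed_set1/hausdorff_accessible/norm_hausdorff.
- move=> x e e0; have [C HC] := eps_subdifferential_bounded fcvx x.
  exists [set y | `|x - y| <= 1]; first exact: near_norm_le.
  apply: (@bounded_set_le _ _ _ (C + `|e|)) => v [y /= yx [vy _]].
  by apply: HC vy; rewrite distrC.
- move=> x v [[xk ek] /= [xkx [_ ek0]] [N [u [infN uG uv]]]].
  rewrite clarke_subdifferential_convex//.
  have FF := infinite_within_proper infN.
  have subN : within N \oo --> \oo by exact: cvg_within.
  apply: (eps_subdifferential_limit fcvx FF _ uv (e := 0)) => //.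
  + exact: cvg_trans (cvg_app _ subN) xkx.
  + exact: cvg_trans (cvg_app _ subN) ek0.
  + have : \forall k \near within N \oo, N k by exact: withinT.
    by apply: filterS => k /uG[].
- move=> x e ecvg; have [e0 ek0] := ecvg.
  rewrite clarke_subdifferential_convex//.
  have [m mE] := argmin_eps_subdifferential_set1 fcvx x (lexx 0).
  have [mx mmin] : argmin enorm (eps_subdifferential f x 0) m by rewrite mE.
  set C := fun k => _.
  have outerL : outer_limit C `<=` argmin enorm (eps_subdifferential f x 0).
    move=> v [N [u [infN uC uv]]].
    have FF := infinite_within_proper infN.
    have NN : \forall k \near within N \oo, N k by exact: withinT.
    have uk k (Nk : N k) := limsup_x_argmin fcvx (e0 k) mx (uC k Nk).
    split.
      apply: (eps_subdifferential_limit fcvx FF (cvg_cst x) uv (ek := e)).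
        have subN : within N \oo --> \oo by exact: cvg_within.
        exact: cvg_trans (cvg_app _ subN) ek0.
      by apply: filterS NN => k /uk[].
    move=> w /mmin; apply: le_trans.
    apply: (@closed_cvg _ _ _ FF u (fun w => enorm w <= enorm m)
      (@enorm_ball_closed R n _) _ v uv).
    by apply: filterS NN => k /uk[].
  have innerL : argmin enorm (eps_subdifferential f x 0) `<=` inner_limit C.
    rewrite mE => _ ->.
    have /choice[w wE] k := ex1 x (e k) (e0 k).
    (* [w k] is in the limsup over [y] tending to [x] as [y] may stay at [x]. *)
    have wC k : C k (w k).
      exists (fun=> x); first exact: cvg_cst.
      exists setT, (fun=> w k); split; [exact: infinite_nat| |exact: cvg_cst].
      by move=> j _; rewrite wE.
    have wk k := limsup_x_argmin fcvx (e0 k) mx (wC k).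
    exists setT, w; split=> //.
    have subT : within setT \oo --> \oo by exact: cvg_within.
    apply: cvg_trans (cvg_app _ subT) _.
    by apply: (cvg_min_subgradient fcvx mE ecvg) => k; have [] := wk k.
  have io := @inner_limit_sub_outer _ _ C.
  split; apply/seteqP; split=> //.
  + exact: subset_trans innerL io.
  + exact: subset_trans io outerL.
Qed.
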